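(* Let $p>1$ and $\lambda\le 0$. For some $\alpha>0$, the equation $$u''-uu'+u|u|^{p-1}-\lambda u=0\quad\text{in }(-\alpha,\alpha)$$ admits a sign-changing solution under the Neumann boundary conditions $u'(-\alpha)=u'(\alpha)=0$.
   Context: A solution on an interval is a real-valued function of class $\mathcal{C}^2$ satisfying the equation in the classical sense; the boundary conditions refer to the values of $u'$ (extended continuously) at $\pm\alpha$. A solution is sign-changing if it takes both positive and negative values. *)

(* Defs.v *)
(* Real analysis over Stdlib's [R], with Coquelicot's total derivative. *)
From Stdlib Require Import Reals.
From Coquelicot Require Import Coquelicot.
Open Scope R_scope.

(* |t|^q for q > 0.  The case t = 0 is separate because [ln 0 = 0] makes
   [Rpower 0 q] equal to 1. *)
Definition abs_pow (t q : R) : R :=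
  if Req_EM_T t 0 then 0 else Rpower (Rabs t) q.

(* Functions are total on R; the predicates below only depend on the values
   of [u] on the open interval (a, b). *)
Definition C2_on (a b : R) (u : R -> R) : Prop :=
  forall x, a < x < b ->
    ex_derive u x /\ ex_derive (Derive u) x /\
    continuous (Derive (Derive u)) x.

Definition is_solution (p lambda a b : R) (u : R -> R) : Prop :=
  C2_on a b u /\
  forall x, a < x < b ->
    Derive (Derive u) x - u x * Derive u x
      + u x * abs_pow (u x) (p - 1) - lambda * u x = 0.

(* u' extends continuously to the endpoints, with value 0 there. *)
Definition neumann (a b : R) (u : R -> R) : Prop :=
  filterlim (Derive u) (at_right a) (locally 0) /\
  filterlim (Derive u) (at_left b) (locally 0).

Definition sign_changing (a b : R) (u : R -> R) : Prop :=
  (exists x, a < x < b /\ 0 < u x) /\ (exists y, a < y < b /\ u y < 0).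

(* Main.v *)
(* In Lienard form the equation reads u' = w + u^2/2, w' = -f(u) with
   f(u) = u|u|^(p-1) - lambda u odd and increasing; it is invariant under
   (t, u) -> (-t, -u), so the solution with u(0) = 0, w(0) = s > 0 is odd and it
   suffices that u' vanishes at some alpha > 0.  While u' > 0 we have w <= s, hence
   u' <= s + u^2/2.  On a window a <= u <= 2a where f(u) >= u^3 ([1,2] if p >= 3,
   [1/2,1] if p < 3), the choice s = a^2/8 gives u' <= 5/8 u^2, which makes
   w + 4/5 u^2 nonincreasing and u' negative at u = 2a.  So u stays below 2a while
   u' > 0, and then w decreases linearly, so u' must vanish.
   As u stays below 2a, f and u^2/2 may be clamped outside [-2a, 2a], which makes the
   system globally Lipschitz. *)
Require Import Defs.
From Stdlib Require Import Reals Lra Lia Classical.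
From Coquelicot Require Import Coquelicot.
Open Scope R_scope.

(** * Contraction in an exponentially weighted norm *)

(** A bound [C] on the Bielecki distance, the supremum of [|x - y| exp (- k |t|)] over the whole
    line. Stated as an inequality, it needs no supremum, which could be infinite. *)
Definition weighted_close (k C : R) (x y : R -> R) : Prop :=
  forall t, Rabs (x t - y t) <= C * exp (k * Rabs t).

Definition everywhere_continuous (x : R -> R) : Prop := forall t, continuous x t.

Lemma exp_le (x y : R) : x <= y -> exp x <= exp y.
Proof.
  intros [H|H]; [now apply Rlt_le, exp_increasing|]. rewrite H. apply Rle_refl.
Qed.

Lemma half_pow_small (M eps : R) : 0 < eps -> exists N, forall n, (N <= n)%nat -> M * (/ 2) ^ n < eps.
Proof.
  intros He.
  assert (L : is_lim_seq (fun n => M * (/ 2) ^ n) 0).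
  { replace (Finite 0) with (Rbar_mult M 0) by (simpl; f_equal; ring).
    apply is_lim_seq_scal_l, is_lim_seq_geom.
    rewrite Rabs_pos_eq; lra. }
  apply is_lim_seq_spec in L.
  destruct (L (mkposreal eps He)) as [N HN].
  exists N; intros n Hn. specialize (HN n Hn). simpl in HN.
  apply Rabs_def2 in HN. lra.
Qed.

Lemma le_half_pow_0 (x M : R) : (forall n, x <= M * (/ 2) ^ n) -> x <= 0.
Proof.
  intros H. destruct (Rle_or_lt x 0) as [|Hx]; [easy|].
  destruct (half_pow_small M x Hx) as [N HN].
  specialize (HN N (le_n _)). specialize (H N). lra.
Qed.

Lemma half_pow_pos n : 0 < (/ 2) ^ n.
Proof. apply pow_lt; lra. Qed.

Section WeightedContraction.

Variables (T : (R -> R) -> R -> R) (k : R).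
Hypothesis T_continuous : forall x, everywhere_continuous x -> everywhere_continuous (T x).
Hypothesis T_contracts : forall x y C,
  everywhere_continuous x -> everywhere_continuous y -> 0 <= C ->
  weighted_close k C x y -> weighted_close k (C / 2) (T x) (T y).

(** Applying [T] to two fixed points changes neither of them but halves any bound on their distance.
    Some finite bound [C] has to be known to start. *)
Lemma fixed_point_unique (C : R) (x y : R -> R) :
  everywhere_continuous x -> everywhere_continuous y -> 0 <= C ->
  (forall t, T x t = x t) -> (forall t, T y t = y t) ->
  weighted_close k C x y -> forall t, x t = y t.
Proof.
  intros cx cy HC fx fy H.
  assert (Hn : forall n, weighted_close k (C * (/ 2) ^ n) x y).
  { induction n as [|n IH].
    - simpl. now rewrite Rmult_1_r.
    - intros t. rewrite <- fx, <- fy.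
      replace (C * (/ 2) ^ S n) with (C * (/ 2) ^ n / 2) by (simpl; field).
      apply T_contracts; auto.
      apply Rmult_le_pos; [lra|]. apply Rlt_le, half_pow_pos. }
  intros t.
  assert (Rabs (x t - y t) <= 0).
  { apply (le_half_pow_0 _ (C * exp (k * Rabs t))). intros n.
    specialize (Hn n t). lra. }
  pose proof (Rabs_pos (x t - y t)).
  assert (x t - y t = 0); [|lra].
  destruct (Req_dec (x t - y t) 0) as [|N]; [easy|]. apply Rabs_pos_lt in N. lra.
Qed.

(** Picard iteration from 0: the steps are bounded by a geometric series of sum [2 * C0]. That bound
    on the limit later supplies the finite distance that uniqueness asks for. *)
Lemma fixed_point_exists (C0 : R) (hC0 : 0 <= C0) (hk : 0 <= k) :
  weighted_close k C0 (T (fun _ => 0)) (fun _ => 0) ->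
  exists u, everywhere_continuous u /\ (forall t, T u t = u t) /\
    weighted_close k (2 * C0) u (fun _ => 0).
Proof.
  intros H0.
  set (x := fix x n := match n with O => fun _ : R => 0 | S m => T (x m) end).
  assert (cx : forall n, everywhere_continuous (x n)).
  { induction n as [|n IH]; simpl; auto. intros t. apply continuous_const. }
  assert (Hs : forall n, weighted_close k (C0 * (/ 2) ^ n) (x (S n)) (x n)).
  { induction n as [|n IH].
    - simpl. now rewrite Rmult_1_r.
    - replace (C0 * (/ 2) ^ S n) with (C0 * (/ 2) ^ n / 2) by (simpl; field).
      apply (T_contracts (x (S n)) (x n)); auto.
      apply Rmult_le_pos; [lra|]. apply Rlt_le, half_pow_pos. }
  assert (Hd : forall n m, weighted_close k (2 * C0 * (/ 2) ^ n) (x (n + m)%nat) (x n)).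
  { intros n m t.
    (* The partial geometric sum is kept exact, so that the induction on [m] closes: the next step,
       [C0 * (/ 2) ^ (n + m)], is precisely the growth of the right-hand side. *)
    assert (Rabs (x (n + m)%nat t - x n t)
            <= 2 * C0 * ((/ 2) ^ n - (/ 2) ^ (n + m)) * exp (k * Rabs t)).
    { induction m as [|m IH].
      - rewrite Nat.add_0_r, !Rminus_diag, Rabs_R0. lra.
      - rewrite Nat.add_succ_r. specialize (Hs (n + m)%nat t).
        replace (x (S (n + m)) t - x n t) with
          ((x (S (n + m)) t - x (n + m)%nat t) + (x (n + m)%nat t - x n t)) by ring.
        eapply Rle_trans; [apply Rabs_triang|].
        replace ((/ 2) ^ S (n + m)) with ((/ 2) ^ (n + m) / 2) by (simpl; field).
        lra. }
    eapply Rle_trans; [eassumption|].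
    apply Rmult_le_compat_r; [apply Rlt_le, exp_pos|].
    apply Rmult_le_compat_l; [lra|]. pose proof (half_pow_pos (n + m)). lra. }
  assert (Hc : forall t, ex_finite_lim_seq (fun n => x n t)).
  { intros t. apply ex_lim_seq_cauchy_corr. intros eps.
    (* Twice the constant [2 * C0], since both [x n] and [x m] are compared with [x N]. *)
    destruct (half_pow_small (4 * C0 * exp (k * Rabs t)) eps (cond_pos eps)) as [N HN].
    exists N. intros n m Hn Hm.
    specialize (HN N (le_n _)).
    pose proof (Hd N (n - N)%nat t) as H1. pose proof (Hd N (m - N)%nat t) as H2.
    replace (N + (n - N))%nat with n in H1 by lia.
    replace (N + (m - N))%nat with m in H2 by lia.
    replace (x n t - x m t) with ((x n t - x N t) - (x m t - x N t)) by ring.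
    eapply Rle_lt_trans; [apply Rabs_triang|]. rewrite Rabs_Ropp. lra. }
  set (u := fun t => real (Lim_seq (fun n => x n t))).
  assert (Hl : forall n, weighted_close k (2 * C0 * (/ 2) ^ n) u (x n)).
  { intros n t.
    assert (L : is_lim_seq (fun m => Rabs (x (m + n)%nat t - x n t)) (Rabs (u t - x n t))).
    { apply (is_lim_seq_abs _ (Finite (u t - x n t))).
      apply is_lim_seq_minus'; [|apply is_lim_seq_const].
      apply is_lim_seq_incr_n with (u := fun m => x m t).
      apply Lim_seq_correct'; auto. }
    apply (is_lim_seq_le _ (fun _ => 2 * C0 * (/ 2) ^ n * exp (k * Rabs t))
             (Finite _) (Finite _)) with (2 := L); [|apply is_lim_seq_const].
    intros m. rewrite Nat.add_comm. apply Hd. }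
  (* Within distance 1 of [t] the weight is at most [W], so the convergence is locally uniform and
     the usual three-epsilon argument applies. *)
  assert (cu : everywhere_continuous u).
  { intros t. apply continuity_pt_filterlim. intros eps Heps.
    set (W := exp (k * (Rabs t + 1))).
    destruct (half_pow_small (2 * C0 * W) (eps / 3)) as [N HN]; [lra|].
    specialize (HN N (le_n _)).
    assert (Hloc : forall t', Rabs (t' - t) < 1 -> Rabs (u t' - x N t') < eps / 3).
    { intros t' Ht'. eapply Rle_lt_trans; [apply Hl|].
      eapply Rle_lt_trans; [|apply HN].
      replace (2 * C0 * W * (/ 2) ^ N) with (2 * C0 * (/ 2) ^ N * W) by ring.
      apply Rmult_le_compat_l.
      - pose proof (half_pow_pos N). apply Rmult_le_pos; lra.
      - assert (Rabs t' <= Rabs t + 1).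
        { replace t' with (t + (t' - t)) by ring.
          pose proof (Rabs_triang t (t' - t)). lra. }
        unfold W. apply exp_le, Rmult_le_compat_l; lra. }
    pose proof (cx N t) as c. apply continuity_pt_filterlim in c.
    destruct (c (eps / 3)) as [d [Hd0 Hd1]]; [lra|].
    exists (Rmin d 1). split; [apply Rmin_pos; lra|].
    intros t' [Ht1 Ht2]. simpl in *. unfold R_dist in *.
    pose proof (Rmin_l d 1). pose proof (Rmin_r d 1).
    assert (A1 := Hloc t' ltac:(lra)).
    assert (A2 := Hloc t ltac:(rewrite Rminus_diag, Rabs_R0; lra)).
    assert (Ht3 : Rabs (t' - t) < d) by lra.
    assert (A3 := Hd1 t' (conj Ht1 Ht3)). simpl in A3. unfold R_dist in A3.
    apply Rabs_def2 in A1, A2, A3. apply Rabs_def1; lra. }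
  exists u. repeat split; auto.
  - intros t.
    (* Both [T u] and [u] are within weighted distance [C0 * (/ 2) ^ n] of [T (x n)], which is
       [x (S n)] by definition. *)
    assert (Rabs (T u t - u t) <= 0) as Hz.
    { apply (le_half_pow_0 _ (2 * C0 * exp (k * Rabs t))). intros n.
      assert (B1 : weighted_close k (2 * C0 * (/ 2) ^ n / 2) (T u) (T (x n))).
      { apply T_contracts; auto. pose proof (half_pow_pos n). apply Rmult_le_pos; lra. }
      specialize (B1 t). pose proof (Hl (S n) t) as B2. simpl in B2.
      replace (T u t - u t) with ((T u t - T (x n) t) - (u t - T (x n) t)) by ring.
      eapply Rle_trans; [apply Rabs_triang|]. rewrite Rabs_Ropp. lra. }
    pose proof (Rabs_pos (T u t - u t)).
    destruct (Req_dec (T u t - u t) 0) as [|N]; [lra|]. apply Rabs_pos_lt in N. lra.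
  - intros t. pose proof (Hl O t) as B. simpl in B. now rewrite Rmult_1_r in B.
Qed.

End WeightedContraction.

(** * Global solutions of Lienard systems *)

Lemma le_of_derive_nonneg (f df : R -> R) (a b : R) :
  a <= b -> (forall t, a <= t <= b -> is_derive f t (df t)) ->
  (forall t, a <= t <= b -> 0 <= df t) -> f a <= f b.
Proof.
  intros Hab Hd Hp.
  destruct (MVT_gen f a b df) as [c [Hc Heq]].
  - intros x Hx. rewrite Rmin_left, Rmax_right in Hx by lra. apply Hd; lra.
  - intros x Hx. rewrite Rmin_left, Rmax_right in Hx by lra.
    apply continuity_pt_filterlim, (ex_derive_continuous f). eexists. apply Hd; lra.
  - rewrite Rmin_left, Rmax_right in Hc by lra.
    specialize (Hp c Hc). assert (0 <= df c * (b - a)) by (apply Rmult_le_pos; lra). lra.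
Qed.

(** The difference [M / k * exp (k * t) - h t] has nonnegative derivative and starts at [M / k]. *)
Lemma primitive_le_exp (h dh : R -> R) (k M : R) :
  0 < k -> 0 <= M -> h 0 = 0 ->
  (forall t, 0 <= t -> is_derive h t (dh t)) ->
  (forall t, 0 <= t -> dh t <= M * exp (k * t)) ->
  forall t, 0 <= t -> h t <= M / k * exp (k * t).
Proof.
  intros Hk HM H0 Hd Hb t Ht.
  assert (M / k * exp (k * 0) - h 0 <= M / k * exp (k * t) - h t).
  { apply (le_of_derive_nonneg (fun t => M / k * exp (k * t) - h t)
             (fun t => M * exp (k * t) - dh t)); auto.
    - intros s Hs. apply (is_derive_minus (fun t => M / k * exp (k * t)) h).
      + auto_derive; [easy|]. field; lra.
      + apply Hd; lra.
    - intros s Hs. specialize (Hb s). lra. }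
  rewrite H0, Rmult_0_r, exp_0 in H.
  assert (0 <= M / k) by (apply Rdiv_le_0_compat; lra). lra.
Qed.

(** Integration from 0 gains a factor [1 / k] in the weighted norm; a large [k] thus turns an
    integral operator with Lipschitz data into a contraction. Negative times reduce to positive ones
    by reflection. *)
Lemma weighted_primitive (h dh : R -> R) (k M : R) :
  0 < k -> 0 <= M -> h 0 = 0 -> (forall t, is_derive h t (dh t)) ->
  (forall t, Rabs (dh t) <= M * exp (k * Rabs t)) ->
  forall t, Rabs (h t) <= M / k * exp (k * Rabs t).
Proof.
  intros Hk HM H0 Hd Hb.
  assert (Hpos : forall h dh : R -> R, h 0 = 0 -> (forall t, is_derive h t (dh t)) ->
    (forall t, Rabs (dh t) <= M * exp (k * Rabs t)) ->
    forall t, 0 <= t -> Rabs (h t) <= M / k * exp (k * t)).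
  { clear h dh H0 Hd Hb. intros h dh H0 Hd Hb t Ht. apply Rabs_le. split.
    - enough (- h t <= M / k * exp (k * t)) by lra.
      apply (primitive_le_exp (fun t => - h t) (fun t => - dh t)); auto.
      + rewrite H0; ring.
      + intros s _. apply (is_derive_opp h), Hd.
      + intros s Hs. specialize (Hb s). rewrite (Rabs_pos_eq s) in Hb by easy.
        pose proof (Rle_abs (- dh s)). rewrite Rabs_Ropp in H. lra.
    - apply (primitive_le_exp h dh); auto.
      intros s Hs. specialize (Hb s). rewrite (Rabs_pos_eq s) in Hb by easy.
      pose proof (Rle_abs (dh s)). lra. }
  intros t. destruct (Rle_or_lt 0 t) as [Ht|Ht].
  - rewrite (Rabs_pos_eq t) by easy. now apply (Hpos h dh).
  - rewrite (Rabs_left t) by easy.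
    replace (h t) with ((fun s => h (- s)) (- t)) by (cbv beta; f_equal; ring).
    apply (Hpos (fun s => h (- s)) (fun s => - dh (- s))); [| | |lra].
    + now rewrite Ropp_0.
    + intros s. replace (- dh (- s)) with (scal (-1) (dh (- s))) by (unfold scal; simpl; unfold mult; simpl; ring).
      apply (is_derive_comp h (fun s => - s)); [apply Hd|]. auto_derive; [easy|ring].
    + intros s. rewrite Rabs_Ropp, <- (Rabs_Ropp s). apply Hb.
Qed.

Definition lipschitz (L : R) (f : R -> R) : Prop :=
  forall x y, Rabs (f x - f y) <= L * Rabs (x - y).

Lemma lipschitz_continuous (L : R) (f : R -> R) (x : R) : 0 < L -> lipschitz L f -> continuous f x.
Proof.
  intros HL H. apply continuity_pt_filterlim. intros eps He.
  exists (eps / L). split; [apply Rdiv_lt_0_compat; lra|].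
  intros y [_ Hy]. simpl in *. unfold R_dist in *.
  eapply Rle_lt_trans; [apply H|].
  apply (Rmult_lt_compat_l L) in Hy; [|easy].
  now replace (L * (eps / L)) with eps in Hy by (field; lra).
Qed.

Lemma is_derive_primitive (f : R -> R) (t : R) :
  everywhere_continuous f -> is_derive (fun t => RInt f 0 t) t (f t).
Proof.
  intros cf. apply (is_derive_RInt f _ 0); [|apply cf].
  apply filter_forall. intros b. apply (RInt_correct (V := R_CompleteNormedModule)), (ex_RInt_continuous (V := R_CompleteNormedModule)).
  intros; apply cf.
Qed.

Lemma is_derive_everywhere_continuous (f df : R -> R) :
  (forall t, is_derive f t (df t)) -> everywhere_continuous f.
Proof. intros H t. apply (ex_derive_continuous f). eexists; apply H. Qed.

(* [u' = g u + w], [w' = - f u] is solved as one integral equation for [u]. *)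
Lemma lienard_global_solution (f g : R -> R) (L s : R) :
  0 < L -> lipschitz L f -> lipschitz L g ->
  (forall x, f (- x) = - f x) -> (forall x, g (- x) = g x) ->
  exists u w : R -> R,
    u 0 = 0 /\ w 0 = s /\
    (forall t, is_derive u t (g (u t) + w t)) /\
    (forall t, is_derive w t (- f (u t))) /\
    (forall t, u (- t) = - u t).
Proof.
  intros HL Lf Lg Of Eg.
  set (W := fun (x : R -> R) t => s - RInt (fun r => f (x r)) 0 t).
  set (T := fun (x : R -> R) t => RInt (fun r => g (x r) + W x r) 0 t).
  assert (cfx : forall x, everywhere_continuous x -> everywhere_continuous (fun r => f (x r))).
  { intros x cx t. apply (continuous_comp x f); [apply cx|]. now apply (lipschitz_continuous L). }
  assert (cgx : forall x, everywhere_continuous x -> everywhere_continuous (fun r => g (x r))).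
  { intros x cx t. apply (continuous_comp x g); [apply cx|]. now apply (lipschitz_continuous L). }
  assert (dW : forall x, everywhere_continuous x -> forall t, is_derive (W x) t (- f (x t))).
  { intros x cx t. unfold W.
    replace (- f (x t)) with (0 - f (x t)) by ring.
    apply (is_derive_minus (fun _ => s) (fun t => RInt (fun r => f (x r)) 0 t)).
    - apply (is_derive_const s).
    - now apply (is_derive_primitive (fun r => f (x r))), cfx. }
  assert (dT : forall x, everywhere_continuous x -> forall t, is_derive (T x) t (g (x t) + W x t)).
  { intros x cx t. apply (is_derive_primitive (fun r => g (x r) + W x r)).
    intros r. apply (continuous_plus (fun r => g (x r)) (W x)); [now apply cgx|].
    now apply (is_derive_everywhere_continuous (W x) (fun t => - f (x t))), dW. }
  assert (W0 : forall x, W x 0 = s) by (intros x; unfold W; rewrite RInt_point; unfold zero; simpl; ring).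
  assert (T0 : forall x, T x 0 = 0) by (intros x; unfold T; rewrite RInt_point; reflexivity).
  (* The integrands of [T x] and [T y] differ by at most [2 * L * C] in weighted norm: [L * C] from
     [g], and [L * C / k <= L * C] from [W], as [k > 1]. Integrating gives [2 * L * C / k <= C / 2],
     as [k >= 4 * L]. *)
  set (k := 4 * L + 1).
  assert (Hk : 1 < k) by (unfold k; lra).
  assert (cT : forall x, everywhere_continuous x -> everywhere_continuous (T x)).
  { intros x cx. apply (is_derive_everywhere_continuous _ (fun t => g (x t) + W x t)). now apply dT. }
  assert (Tc : forall x y C, everywhere_continuous x -> everywhere_continuous y -> 0 <= C ->
    weighted_close k C x y -> weighted_close k (C / 2) (T x) (T y)).
  { intros x y C cx cy HC H.
    assert (HW : forall t, Rabs (W x t - W y t) <= L * C / k * exp (k * Rabs t)).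
    { apply (weighted_primitive _ (fun t => - f (x t) - - f (y t))); try lra.
      - apply Rmult_le_pos; lra.
      - rewrite !W0; ring.
      - intros t. apply (is_derive_minus (W x) (W y)); now apply dW.
      - intros t. replace (- f (x t) - - f (y t)) with (- (f (x t) - f (y t))) by ring.
        rewrite Rabs_Ropp. eapply Rle_trans; [apply Lf|].
        rewrite Rmult_assoc. apply Rmult_le_compat_l; [lra|]. apply H. }
    assert (HLCk : L * C / k <= L * C).
    { apply Rle_div_l; [lra|]. assert (0 <= L * C) by (apply Rmult_le_pos; lra). nra. }
    assert (HT : forall t, Rabs (T x t - T y t) <= 2 * L * C / k * exp (k * Rabs t)).
    { apply (weighted_primitive _ (fun t => (g (x t) + W x t) - (g (y t) + W y t))); try lra.
      - apply Rmult_le_pos; lra.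
      - rewrite !T0; ring.
      - intros t. apply (is_derive_minus (T x) (T y)); now apply dT.
      - intros t. specialize (HW t). specialize (H t). pose proof (Lg (x t) (y t)) as G.
        pose proof (exp_pos (k * Rabs t)) as E.
        replace (g (x t) + W x t - (g (y t) + W y t))
          with ((g (x t) - g (y t)) + (W x t - W y t)) by ring.
        eapply Rle_trans; [apply Rabs_triang|].
        apply (Rmult_le_compat_r (exp (k * Rabs t))) in HLCk; [|lra].
        apply (Rmult_le_compat_l L) in H; [|lra]. lra. }
    intros t. eapply Rle_trans; [apply HT|].
    apply Rmult_le_compat_r; [apply Rlt_le, exp_pos|].
    apply Rle_div_l; [lra|]. unfold k. nra. }
  set (C0 := (Rabs (g 0 + s) + Rabs (f 0)) / k).
  assert (HC0 : 0 <= C0).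
  { apply Rdiv_le_0_compat; [|lra]. pose proof (Rabs_pos (g 0 + s)). pose proof (Rabs_pos (f 0)). lra. }
  assert (c0 : everywhere_continuous (fun _ => 0)) by (intros t; apply continuous_const).
  assert (f0 : f 0 = 0) by (specialize (Of 0); rewrite Ropp_0 in Of; lra).
  (* Along the zero function the integrand is the constant [g 0 + s], because oddness gives
     [f 0 = 0]. *)
  assert (TB : weighted_close k C0 (T (fun _ => 0)) (fun _ => 0)).
  { intros t. rewrite Rminus_0_r.
    apply (weighted_primitive _ (fun r => g 0 + W (fun _ => 0) r)); try lra.
    - pose proof (Rabs_pos (g 0 + s)). pose proof (Rabs_pos (f 0)). lra.
    - apply T0.
    - now apply (dT (fun _ => 0)).
    - intros r. unfold W. rewrite RInt_const, f0.
      unfold scal; simpl; unfold mult; simpl. rewrite Rabs_R0, Rmult_0_r, Rminus_0_r, Rplus_0_r.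
      pose proof (exp_le 0 (k * Rabs r)) as E. rewrite exp_0 in E.
      assert (0 <= k * Rabs r) by (apply Rmult_le_pos; [lra|apply Rabs_pos]).
      pose proof (Rabs_pos (g 0 + s)). specialize (E H). nra. }
  destruct (fixed_point_exists T k cT Tc C0 HC0 ltac:(lra) TB) as (u & cu & fu & bu).
  exists u, (W u).
  assert (du : forall t, is_derive u t (g (u t) + W u t)).
  { intros t. apply (is_derive_ext (T u)); [exact fu|]. now apply dT. }
  split; [now rewrite <- fu|]. split; [apply W0|].
  split; [exact du|]. split; [now apply dW|].
  (* Oddness comes from uniqueness: the reflection [v] is also a fixed point of [T]. Both satisfy
     the bound [2 * C0], so they are at distance at most [4 * C0]. *)
  set (v := fun t => - u (- t)).
  assert (cv : everywhere_continuous v).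
  { intros t. apply (continuous_opp (fun t => u (- t))).
    apply (continuous_comp (fun t => - t) u); [|apply cu].
    apply (ex_derive_continuous (fun t => - t)). now auto_derive. }
  assert (dopp : forall h l t, is_derive h (- t) l -> is_derive (fun t => h (- t)) t (- l)).
  { intros h l t Hh. replace (- l) with (scal (-1) l) by (unfold scal; simpl; unfold mult; simpl; ring).
    apply (is_derive_comp h (fun s => - s)); [exact Hh|]. auto_derive; [easy|ring]. }
  (* Primitives of the same function that agree at 0 coincide: this is the weighted bound with
     [M = 0]. *)
  assert (deq : forall h1 h2 d : R -> R, h1 0 = h2 0 -> (forall t, is_derive h1 t (d t)) ->
    (forall t, is_derive h2 t (d t)) -> forall t, h1 t = h2 t).
  { intros h1 h2 d H0 H1 H2 t.
    pose proof (weighted_primitive (fun t => h1 t - h2 t) (fun t => d t - d t) 1 0) as Z.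
    enough (Rabs (h1 t - h2 t) <= 0 / 1 * exp (1 * Rabs t)).
    { unfold Rdiv in H. rewrite !Rmult_0_l in H. pose proof (Rabs_pos (h1 t - h2 t)).
      destruct (Req_dec (h1 t - h2 t) 0) as [|N]; [lra|]. apply Rabs_pos_lt in N. lra. }
    apply Z; try lra.
    - intros r. now apply (is_derive_minus h1 h2).
    - intros r. rewrite Rminus_diag, Rabs_R0. lra. }
  assert (Wv : forall t, W v t = W u (- t)).
  { apply (deq _ _ (fun t => - f (v t))).
    - now rewrite Ropp_0, !W0.
    - now apply dW.
    - intros t. unfold v. rewrite Of. apply dopp. now apply dW. }
  assert (fv : forall t, T v t = v t).
  { apply (deq _ _ (fun t => g (v t) + W v t)).
    - unfold v. rewrite T0, Ropp_0, <- fu, T0. ring.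
    - now apply dT.
    - intros t. rewrite Wv. unfold v. rewrite Eg.
      rewrite <- (Ropp_involutive (g (u (- t)) + W u (- t))).
      apply (is_derive_opp (fun t => u (- t))), dopp, du. }
  intros t.
  enough (u t = v t) as E by (unfold v in E; lra).
  apply (fixed_point_unique T k Tc (4 * C0)); auto; [lra|].
  intros r. unfold v. pose proof (bu r) as B1. pose proof (bu (- r)) as B2.
  rewrite Rabs_Ropp in B2. rewrite Rminus_0_r in B1, B2.
  replace (u r - - u (- r)) with (u r + u (- r)) by ring.
  eapply Rle_trans; [apply Rabs_triang|]. lra.
Qed.

(** * The nonlinearity and its truncation *)

Lemma abs_pow_opp (x q : R) : abs_pow (- x) q = abs_pow x q.
Proof.
  unfold abs_pow. rewrite Rabs_Ropp.
  destruct (Req_EM_T (- x) 0), (Req_EM_T x 0); try easy; exfalso; lra.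
Qed.

Lemma abs_pow_nonneg (x q : R) : 0 <= abs_pow x q.
Proof.
  unfold abs_pow. destruct (Req_EM_T x 0); [lra|]. apply Rlt_le, exp_pos.
Qed.

Lemma abs_pow_pos_eq (x q : R) : 0 < x -> abs_pow x q = Rpower x q.
Proof.
  intros H. unfold abs_pow. destruct (Req_EM_T x 0); [lra|]. now rewrite Rabs_pos_eq by lra.
Qed.

(** For [y > 0] this is the mean value theorem for [x^p]. It does not reach [y = 0], where [Rpower]
    is built on the logarithm; there [x^(p-1) <= B^(p-1)] and [1 <= p] suffice. *)
Lemma power_increment (p B x y : R) : 1 < p -> 0 <= y <= x -> x <= B ->
  0 <= x * abs_pow x (p - 1) - y * abs_pow y (p - 1) <= p * Rpower B (p - 1) * (x - y).
Proof.
  intros Hp [[Hy|Hy] Hx] HB.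
  - destruct (MVT_gen (fun x => Rpower x p) y x (fun x => p * Rpower x (p - 1))) as [c [Hc E]];
      rewrite ?Rmin_left, ?Rmax_right in * by lra.
    + intros z Hz. apply is_derive_Reals, derivable_pt_lim_power. lra.
    + intros z Hz. apply derivable_continuous_pt. eexists. apply derivable_pt_lim_power. lra.
    + rewrite !abs_pow_pos_eq by lra.
      assert (R1 : forall z, 0 < z -> z * Rpower z (p - 1) = Rpower z p).
      { intros z Hz. rewrite <- (Rpower_1 z) at 1 by easy. rewrite <- Rpower_plus. f_equal; ring. }
      rewrite !R1 by lra. rewrite E.
      assert (0 < Rpower c (p - 1)) by apply exp_pos.
      assert (Rpower c (p - 1) <= Rpower B (p - 1)) by (apply Rle_Rpower_l; lra).
      split; [apply Rmult_le_pos; [apply Rmult_le_pos|]; lra|].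
      apply Rmult_le_compat_r; [lra|]. apply Rmult_le_compat_l; lra.
  - subst y. rewrite Rmult_0_l, 2!Rminus_0_r.
    split; [apply Rmult_le_pos; [lra|apply abs_pow_nonneg]|].
    destruct Hx as [Hx|Hx]; [|subst x; lra].
    rewrite abs_pow_pos_eq by easy.
    assert (0 < Rpower x (p - 1)) by apply exp_pos.
    assert (Rpower x (p - 1) <= Rpower B (p - 1)) by (apply Rle_Rpower_l; lra).
    rewrite Rmult_comm. apply Rmult_le_compat_r; [lra|].
    rewrite <- (Rmult_1_l (Rpower x (p - 1))). apply Rmult_le_compat; lra.
Qed.

Definition force (p lambda x : R) : R := x * abs_pow x (p - 1) - lambda * x.

Lemma force_opp (p lambda x : R) : force p lambda (- x) = - force p lambda x.
Proof. unfold force. rewrite abs_pow_opp. ring. Qed.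

(** The sign of [lambda] makes the linear term nondecreasing too. The lower bound is the
    monotonicity used in the shooting, the upper one gives the Lipschitz constant. *)
Lemma force_increment (p lambda B x y : R) : 1 < p -> lambda <= 0 -> 0 <= y <= x -> x <= B ->
  0 <= force p lambda x - force p lambda y <= (p * Rpower B (p - 1) - lambda) * (x - y).
Proof.
  intros Hp Hl Hy HB. pose proof (power_increment p B x y Hp Hy HB) as H.
  unfold force. assert (0 <= - lambda * (x - y)) by (apply Rmult_le_pos; lra). lra.
Qed.

(** Oddness moves two negative arguments to the positive side; arguments of opposite sign are
    compared through 0. *)
Lemma force_lipschitz (p lambda B x y : R) : 1 < p -> lambda <= 0 ->
  -B <= x <= B -> -B <= y <= B ->
  Rabs (force p lambda x - force p lambda y) <= (p * Rpower B (p - 1) - lambda) * Rabs (x - y).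
Proof.
  intros Hp Hl.
  assert (W : forall x y, -B <= x <= B -> -B <= y <= B -> y <= x ->
    0 <= force p lambda x - force p lambda y <= (p * Rpower B (p - 1) - lambda) * (x - y)).
  { clear x y. intros x y Hx Hy Hxy.
    assert (F0 : force p lambda 0 = 0) by (unfold force; ring).
    destruct (Rle_or_lt 0 y); [apply force_increment; lra|].
    destruct (Rle_or_lt x 0).
    - pose proof (force_increment p lambda B (- y) (- x) Hp Hl ltac:(lra) ltac:(lra)) as H1.
      rewrite !force_opp in H1. lra.
    - pose proof (force_increment p lambda B x 0 Hp Hl ltac:(lra) ltac:(lra)) as H1.
      pose proof (force_increment p lambda B (- y) 0 Hp Hl ltac:(lra) ltac:(lra)) as H2.
      rewrite force_opp in H2. lra. }
  intros Hx Hy. destruct (Rle_or_lt y x).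
  - specialize (W x y Hx Hy H). rewrite !Rabs_pos_eq; lra.
  - specialize (W y x Hy Hx ltac:(lra)).
    rewrite (Rabs_minus_sym _ (force p lambda y)), (Rabs_minus_sym x), !Rabs_pos_eq; lra.
Qed.

(* The window [a, 2a] lies on the side of 1 where [u^p] dominates [u^3]. *)
Lemma force_ge_cube (p lambda : R) : 1 < p -> lambda <= 0 ->
  exists a, 0 < a /\ forall x, a <= x <= 2 * a -> x * (x * x) <= force p lambda x.
Proof.
  intros Hp Hl.
  assert (K : forall x, 0 < x -> x * x <= Rpower x (p - 1) -> x * (x * x) <= force p lambda x).
  { intros x Hx H. unfold force. rewrite abs_pow_pos_eq by easy.
    apply (Rmult_le_compat_l x) in H; [|lra].
    assert (0 <= - lambda * x) by (apply Rmult_le_pos; lra). lra. }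
  assert (S : forall x, 0 < x -> x * x = Rpower x 2).
  { intros x Hx. replace 2 with (1 + 1) by ring. rewrite Rpower_plus, !Rpower_1 by easy. ring. }
  destruct (Rle_or_lt 3 p) as [H3|H3].
  - exists 1. split; [lra|]. intros x Hx. apply K; [lra|].
    rewrite S by lra. apply Rle_Rpower; lra.
  - exists (/ 2). split; [lra|]. intros x Hx. apply K; [lra|].
    rewrite S by lra. unfold Rpower. apply exp_le.
    (* On [[1/2, 1]] the smaller exponent, [p - 1 < 2], gives the larger power. *)
    assert (ln x <= 0) by (rewrite <- ln_1; apply ln_le; lra). nra.
Qed.

Definition clamp (B x : R) : R := Rmax (- B) (Rmin B x).

Lemma clamp_range (B x : R) : 0 <= B -> - B <= clamp B x <= B.
Proof. intros HB. unfold clamp, Rmax, Rmin. repeat destruct Rle_dec; lra. Qed.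

Lemma clamp_id (B x : R) : - B <= x <= B -> clamp B x = x.
Proof. intros H. unfold clamp, Rmax, Rmin. repeat destruct Rle_dec; lra. Qed.

Lemma clamp_opp (B x : R) : 0 <= B -> clamp B (- x) = - clamp B x.
Proof. intros HB. unfold clamp, Rmax, Rmin. repeat destruct Rle_dec; lra. Qed.

Lemma clamp_nonexpansive (B x y : R) : 0 <= B -> Rabs (clamp B x - clamp B y) <= Rabs (x - y).
Proof.
  intros HB. unfold clamp, Rmax, Rmin.
  repeat destruct Rle_dec; unfold Rabs; repeat destruct Rcase_abs; lra.
Qed.

(** The zero is the supremum [a] of the times up to which [v] stays positive: [v a > 0] would let
    positivity continue past [a], and [v a < 0] would contradict positivity just before [a]. *)
Lemma first_zero (v : R -> R) (t1 : R) :
  everywhere_continuous v -> 0 < v 0 -> 0 <= t1 -> v t1 <= 0 ->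
  exists a, 0 < a /\ v a = 0 /\ forall t, 0 <= t < a -> 0 < v t.
Proof.
  intros cv H0 Ht1 Hv1.
  set (E := fun t => 0 <= t /\ forall s, 0 <= s <= t -> 0 < v s).
  assert (E0 : E 0) by (split; [lra|]; intros s Hs; now replace s with 0 by lra).
  assert (Eb : bound E).
  { exists t1. intros t [Ht H]. destruct (Rle_or_lt t t1) as [|L]; [easy|].
    specialize (H t1). lra. }
  destruct (completeness E Eb (ex_intro _ 0 E0)) as [a [Ha1 Ha2]].
  assert (Ha0 : 0 <= a) by now apply Ha1.
  assert (Hlt : forall t, 0 <= t < a -> 0 < v t).
  { intros t Ht. destruct (Rlt_or_le 0 (v t)) as [|N]; [easy|].
    assert (a <= t); [|lra]. apply Ha2. intros r [Hr H].
    destruct (Rle_or_lt r t) as [|L]; [easy|]. specialize (H t). lra. }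
  assert (near : forall t eps, 0 < eps ->
            exists d, 0 < d /\ forall s, Rabs (s - t) < d -> Rabs (v s - v t) < eps).
  { intros t eps He. pose proof (cv t) as c. apply continuity_pt_filterlim in c.
    destruct (c eps He) as [d [Hd Hs]]. exists d. split; [easy|]. intros s Hst.
    destruct (Req_dec s t) as [->|N]; [now rewrite Rminus_diag, Rabs_R0|].
    apply (Hs s). split; [split; [exact I|now apply not_eq_sym]|exact Hst]. }
  assert (Hle : v a <= 0).
  { destruct (Rle_or_lt (v a) 0) as [|P]; [easy|].
    destruct (near a (v a) P) as [d [Hd Hs]].
    assert (a + d / 2 <= a); [|lra]. apply Ha1. split; [lra|]. intros s Hsa.
    destruct (Rlt_or_le s a); [apply Hlt; lra|].
    assert (Q : Rabs (s - a) < d) by (rewrite Rabs_pos_eq; lra).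
    apply Hs, Rabs_def2 in Q. lra. }
  assert (Hapos : 0 < a).
  { destruct Ha0 as [|<-]; [easy|]. lra. }
  exists a. split; [easy|]. split; [|easy].
  destruct Hle as [N|]; [|easy]. exfalso.
  destruct (near a (- v a)) as [d [Hd Hs]]; [lra|].
  (* The maximum with 0 keeps the test point inside [[0, a)], where [v] is positive. *)
  pose proof (Rmax_l 0 (a - d / 2)). pose proof (Rmax_r 0 (a - d / 2)).
  assert (L : Rmax 0 (a - d / 2) < a) by (apply Rmax_lub_lt; lra).
  assert (P := Hlt (Rmax 0 (a - d / 2)) ltac:(lra)).
  assert (Q : Rabs (Rmax 0 (a - d / 2) - a) < d) by (apply Rabs_def1; lra).
  apply Hs, Rabs_def2 in Q. lra.
Qed.

(** * Shooting *)

Lemma half_square_clamp_lipschitz (B : R) : 0 <= B -> lipschitz B (fun x => (clamp B x) ^ 2 / 2).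
Proof.
  intros HB x y.
  replace (clamp B x ^ 2 / 2 - clamp B y ^ 2 / 2)
    with ((clamp B x + clamp B y) / 2 * (clamp B x - clamp B y)) by field.
  rewrite Rabs_mult. pose proof (clamp_range B x HB). pose proof (clamp_range B y HB).
  apply Rmult_le_compat; try apply Rabs_pos; [apply Rabs_le; lra|].
  now apply clamp_nonexpansive.
Qed.

Lemma force_pos (p lambda x : R) : lambda <= 0 -> 0 < x -> 0 < force p lambda x.
Proof.
  intros Hl Hx. unfold force. rewrite abs_pow_pos_eq by easy.
  assert (0 < x * Rpower x (p - 1)) by (apply Rmult_lt_0_compat; [easy|apply exp_pos]).
  assert (0 <= - lambda * x) by (apply Rmult_le_pos; lra). lra.
Qed.

Lemma lt_of_derive_pos (f df : R -> R) (a b : R) :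
  a < b -> (forall t, a <= t <= b -> is_derive f t (df t)) ->
  (forall t, a <= t <= b -> 0 < df t) -> f a < f b.
Proof.
  intros Hab Hd Hp.
  apply (incr_function_le f a b df); simpl; try lra; intros; [apply Hd|apply Hp]; lra.
Qed.

Section Shooting.

Variables (p lambda a : R) (u w : R -> R).
Hypotheses (hp : 1 < p) (hlambda : lambda <= 0) (ha : 0 < a).
Hypothesis cube : forall x, a <= x <= 2 * a -> x * (x * x) <= force p lambda x.

Let f x := force p lambda (clamp (2 * a) x).
Let v t := (clamp (2 * a) (u t)) ^ 2 / 2 + w t.

Hypotheses (u0 : u 0 = 0) (w0 : w 0 = a ^ 2 / 8).
Hypothesis du : forall t, is_derive u t (v t).
Hypothesis dw : forall t, is_derive w t (- f (u t)).

Lemma u_nondecreasing (t1 : R) : (forall t, 0 <= t <= t1 -> 0 < v t) ->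
  forall r t, 0 <= r <= t -> t <= t1 -> u r <= u t.
Proof.
  intros H r t Hr Ht. apply (le_of_derive_nonneg u v); [lra|auto|].
  intros x Hx. apply Rlt_le, H; lra.
Qed.

Lemma f_nonneg (x : R) : 0 <= x -> 0 <= f x.
Proof.
  intros Hx. unfold f.
  assert (H : 0 <= clamp (2 * a) x).
  { unfold clamp, Rmax, Rmin. repeat destruct Rle_dec; lra. }
  destruct H as [H|<-]; [now apply Rlt_le, force_pos|]. unfold force. lra.
Qed.

(** While [v = u'] is positive, [u] rises from 0, so [w' = - f u <= 0]. *)
Lemma w_le_start (t1 : R) : 0 <= t1 -> (forall t, 0 <= t <= t1 -> 0 < v t) -> w t1 <= a ^ 2 / 8.
Proof.
  intros Ht1 H. rewrite <- w0. apply Ropp_le_cancel.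
  apply (le_of_derive_nonneg (fun t => - w t) (fun t => f (u t))); [easy| |].
  - intros t _. rewrite <- (Ropp_involutive (f (u t))). apply (is_derive_opp w), dw.
  - intros t Ht. apply f_nonneg. rewrite <- u0. apply (u_nondecreasing t1 H); lra.
Qed.

Lemma continuity_u : continuity u.
Proof. intros t. apply derivable_continuous_pt. eexists. apply is_derive_Reals, du. Qed.

(* If [u] reached [2a], then [u' <= 5/8 u^2] on [a <= u <= 2a], so that
   [w + 4/5 u^2] would decrease there and force [u' < 0] at [u = 2a]. *)
Lemma u_stays_below (t1 : R) : 0 <= t1 -> (forall t, 0 <= t <= t1 -> 0 < v t) -> u t1 < 2 * a.
Proof.
  intros Ht1 Hv. destruct (Rlt_or_le (u t1) (2 * a)) as [|Hbig]; [easy|exfalso].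
  pose proof (u_nondecreasing t1 Hv) as mono.
  (* The times [ta] and [tb], at which [u] equals [a] and [2 * a], delimit the passage through the
     window; there the clamp is the identity. *)
  destruct (IVT_gen u 0 t1 (2 * a) continuity_u) as [tb [Htb Eb]].
  { rewrite u0, Rmin_left, Rmax_right; lra. }
  rewrite Rmin_left, Rmax_right in Htb by lra.
  destruct (IVT_gen u 0 tb a continuity_u) as [ta [Hta Ea]].
  { rewrite u0, Eb, Rmin_left, Rmax_right; lra. }
  rewrite Rmin_left, Rmax_right in Hta by lra.
  assert (win : forall t, ta <= t <= tb -> a <= u t <= 2 * a).
  { intros t Ht. rewrite <- Eb, <- Ea at 1. split; apply mono; lra. }
  assert (vE : forall t, ta <= t <= tb -> v t = u t ^ 2 / 2 + w t).
  { intros t Ht. unfold v. rewrite clamp_id; [easy|]. specialize (win t Ht). lra. }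
  assert (wle : forall t, 0 <= t <= t1 -> w t <= a ^ 2 / 8).
  { intros t Ht. apply w_le_start; [lra|]. intros; apply Hv; lra. }
  assert (D : - (w ta + 4 / 5 * u ta ^ 2) <= - (w tb + 4 / 5 * u tb ^ 2)).
  { apply (le_of_derive_nonneg (fun t => - (w t + 4 / 5 * u t ^ 2))
             (fun t => f (u t) - 8 / 5 * (u t * v t))); [lra| |].
    - intros t _. auto_derive.
      + split; [eexists; apply dw|]. split; [eexists; apply du|easy].
      + change (fun x : R => w x) with w; change (fun x : R => u x) with u.
        rewrite (is_derive_unique w t _ (dw t)), (is_derive_unique u t _ (du t)). field.
    - intros t Ht. pose proof (win t Ht) as Hu. specialize (wle t ltac:(lra)).
      rewrite vE by easy. unfold f. rewrite clamp_id by lra.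
      pose proof (cube (u t) Hu).
      (* From [w <= a^2 / 8] and [a <= u]: the coefficient is [1/2 + 1/8]. Then
         [8/5 * u * v <= u^3 <= f u], which explains the factor [4/5]. *)
      assert (u t ^ 2 / 2 + w t <= 5 / 8 * u t ^ 2) by nra.
      assert (u t * (u t ^ 2 / 2 + w t) <= u t * (5 / 8 * u t ^ 2)) by (apply Rmult_le_compat_l; lra).
      lra. }
  (* Now [w tb <= a^2 / 8 - 4/5 * 3 * a^2], so [v tb <= (2 + 1/8 - 12/5) * a^2 < 0]. *)
  pose proof (wle ta ltac:(lra)). pose proof (Hv tb ltac:(lra)) as P.
  rewrite vE in P by lra. rewrite Eb in *. rewrite Ea in *. nra.
Qed.

(** Otherwise [u] increases forever below [2 * a]. After time 1, an arbitrary positive time, [f u]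
    is at least [m = f (u 1) > 0], so [w] tends to minus infinity while [u^2 / 2] stays bounded. *)
Lemma v_reaches_zero : exists t, 0 <= t /\ v t <= 0.
Proof.
  apply NNPP. intros N.
  assert (Hv : forall t, 0 <= t -> 0 < v t).
  { intros t Ht. apply Rnot_le_lt. intros L. apply N. now exists t. }
  assert (below : forall t, 0 <= t -> u t < 2 * a).
  { intros t Ht. apply u_stays_below; [easy|]. intros; apply Hv; lra. }
  assert (mono : forall r t, 0 <= r <= t -> u r <= u t).
  { intros r t Hr. apply (u_nondecreasing t); try lra. intros; apply Hv; lra. }
  assert (u1 : 0 < u 1).
  { rewrite <- u0. apply (lt_of_derive_pos u v); [lra|now intros; apply du|]. intros; apply Hv; lra. }
  set (m := f (u 1)).
  assert (fE : forall t, 1 <= t -> f (u t) = force p lambda (u t)).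
  { intros t Ht. unfold f. rewrite clamp_id; [easy|].
    specialize (mono 1 t ltac:(lra)). specialize (below t ltac:(lra)). lra. }
  assert (Hm : 0 < m) by (unfold m; rewrite fE by lra; now apply force_pos).
  assert (wb : forall t, 1 <= t -> w t <= a ^ 2 / 8 + m - m * t).
  { intros t Ht.
    assert (- (w 1 + m * 1) <= - (w t + m * t)).
    { apply (le_of_derive_nonneg (fun t => - (w t + m * t)) (fun t => f (u t) - m)); [easy| |].
      - intros r _. auto_derive; [eexists; apply dw|].
        change (fun x : R => w x) with w. rewrite (is_derive_unique w r _ (dw r)). ring.
      - intros r Hr. unfold m. rewrite !fE by lra.
        pose proof (force_increment p lambda (u r) (u r) (u 1) hp hlambda) as Q.
        specialize (mono 1 r ltac:(lra)). specialize (Q ltac:(lra) ltac:(lra)). lra. }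
    pose proof (w_le_start 1 ltac:(lra) ltac:(intros; apply Hv; lra)). unfold m in *. lra. }
  (* Chosen so that the linear bound gives [w t <= - 2 * a^2], which outweighs
     [u t ^ 2 / 2 < 2 * a^2]. *)
  set (t := 1 + (2 * a ^ 2 + a ^ 2 / 8) / m).
  assert (Ht : 1 <= t).
  { unfold t. assert (0 <= (2 * a ^ 2 + a ^ 2 / 8) / m) by (apply Rdiv_le_0_compat; nra). lra. }
  assert (m * t = m + (2 * a ^ 2 + a ^ 2 / 8)) by (unfold t; field; lra).
  specialize (wb t Ht). specialize (Hv t ltac:(lra)). unfold v in Hv.
  rewrite clamp_id in Hv; [|specialize (mono 1 t ltac:(lra)); specialize (below t ltac:(lra)); lra].
  assert (0 < u t < 2 * a) by (specialize (mono 1 t ltac:(lra)); specialize (below t ltac:(lra)); lra).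
  nra.
Qed.

End Shooting.

(** * Removing the truncation and reading off the boundary values *)

Theorem theorem2p12 (p lambda : R) (hp : 1 < p) (hlambda : lambda <= 0) :
  exists alpha : R, 0 < alpha /\
    exists u : R -> R,
      is_solution p lambda (- alpha) alpha u /\
      neumann (- alpha) alpha u /\
      sign_changing (- alpha) alpha u.
Proof.
  destruct (force_ge_cube p lambda hp hlambda) as (a & ha & cube).
  set (B := 2 * a).
  set (f := fun x => force p lambda (clamp B x)).
  set (g := fun x => clamp B x ^ 2 / 2).
  set (K := p * Rpower B (p - 1) - lambda).
  assert (HB : 0 < B) by (unfold B; lra).
  assert (HK : 0 < K).
  { unfold K. assert (0 < p * Rpower B (p - 1)) by (apply Rmult_lt_0_compat; [lra|apply exp_pos]). lra. }
  (* [K] serves for [f] and [B] for [g]; their sum is a common Lipschitz constant. *)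
  assert (Lf : lipschitz (K + B) f).
  { intros x y. unfold f.
    pose proof (force_lipschitz p lambda B (clamp B x) (clamp B y) hp hlambda
      (clamp_range B x ltac:(lra)) (clamp_range B y ltac:(lra))) as H. fold K in H.
    pose proof (clamp_nonexpansive B x y ltac:(lra)) as H1.
    apply (Rmult_le_compat_l K) in H1; [|lra].
    assert (0 <= B * Rabs (x - y)) by (apply Rmult_le_pos; [lra|apply Rabs_pos]). lra. }
  assert (Lg : lipschitz (K + B) g).
  { intros x y.
    assert (H : Rabs (g x - g y) <= B * Rabs (x - y)) by (apply half_square_clamp_lipschitz; lra).
    assert (0 <= K * Rabs (x - y)) by (apply Rmult_le_pos; [lra|apply Rabs_pos]). lra. }
  destruct (lienard_global_solution f g (K + B) (a ^ 2 / 8)) as (u & w & u0 & w0 & du & dw & odd); auto.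
  { lra. }
  { intros x. unfold f. rewrite clamp_opp by lra. apply force_opp. }
  { intros x. unfold g. rewrite clamp_opp by lra. field. }
  set (v := fun t => g (u t) + w t).
  assert (Dv : forall t, Derive u t = v t) by (intros t; apply is_derive_unique, du).
  pose proof (is_derive_everywhere_continuous u v du) as cu.
  assert (cf : everywhere_continuous (fun t => f (u t))).
  { intros t. apply (continuous_comp u f); [apply cu|]. apply (lipschitz_continuous (K + B)); [lra|easy]. }
  assert (cv : everywhere_continuous v).
  { intros t. apply (continuous_plus (fun t => g (u t)) w).
    - apply (continuous_comp u g); [apply cu|]. apply (lipschitz_continuous (K + B)); [lra|easy].
    - now apply (is_derive_everywhere_continuous w (fun t => - f (u t))). }
  (* The derivative of an odd function is even, so a zero of [u'] at [alpha] is matched by one at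
     [- alpha]. *)
  assert (ev : forall t, v (- t) = v t).
  { intros t. rewrite <- !Dv.
    rewrite <- (Ropp_involutive (Derive u (- t))).
    symmetry. apply is_derive_unique.
    apply (is_derive_ext (fun t => - u (- t))).
    { intros s. rewrite odd. apply Ropp_involutive. }
    apply (is_derive_opp (fun t => u (- t))).
    replace (- Derive u (- t)) with (scal (-1) (Derive u (- t)))
      by (unfold scal; simpl; unfold mult; simpl; ring).
    apply (is_derive_comp u (fun s => - s)); [rewrite Dv; apply du|]. auto_derive; [easy|ring]. }
  destruct (v_reaches_zero p lambda a u w hp hlambda ha cube u0 w0 du dw) as (t1 & Ht1 & Hv1).
  destruct (first_zero v t1 cv) as (alpha & Halpha & Hz & Hpos); auto.
  { unfold v, g. rewrite u0, w0. rewrite clamp_id by lra. nra. }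
  (* Before its first zero [v] is positive, so [u] lies between 0 and [2 * a] and the clamp is
     inactive. *)
  assert (bnd : forall t, 0 <= t < alpha -> - B <= u t <= B).
  { intros t Ht.
    assert (H : forall s, 0 <= s <= t -> 0 < v s) by (intros; apply Hpos; lra).
    pose proof (u_stays_below p lambda a u w hlambda ha cube u0 w0 du dw t ltac:(lra) H).
    pose proof (u_nondecreasing a u w du t H 0 t ltac:(lra) ltac:(lra)).
    unfold B. lra. }
  assert (bnd' : forall t, - alpha < t < alpha -> - B <= u t <= B).
  { intros t Ht. destruct (Rle_or_lt 0 t); [apply bnd; lra|].
    specialize (bnd (- t) ltac:(lra)). rewrite odd in bnd. lra. }
  assert (interior : forall t, - alpha < t < alpha -> locally t (fun y => - alpha < y < alpha)).
  { intros t Ht. apply (filter_and (fun y => - alpha < y) (fun y => y < alpha));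
      [apply open_gt|apply open_lt]; easy. }
  (* The clamp itself has corners, so [u'] is first replaced, near [t], by the unclamped
     [u^2 / 2 + w]. *)
  assert (D2 : forall t, - alpha < t < alpha -> is_derive (Derive u) t (u t * v t - f (u t))).
  { intros t Ht. apply (is_derive_ext_loc (fun y => u y ^ 2 / 2 + w y)).
    - apply (filter_imp (fun y => - alpha < y < alpha)); [|now apply interior].
      intros y Hy. rewrite Dv. unfold v, g. now rewrite clamp_id by now apply bnd'.
    - auto_derive; [split; [eexists; apply du|split; [eexists; apply dw|easy]]|].
      change (fun x : R => w x) with w; change (fun x : R => u x) with u.
        rewrite (is_derive_unique w t _ (dw t)), (is_derive_unique u t _ (du t)). unfold v. field. }
  exists alpha. split; [easy|]. exists u. repeat split.
  - eexists; apply du.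
  - eexists; now apply D2.
  - apply (continuous_ext_loc _ (fun t => u t * v t - f (u t))).
    + apply (filter_imp (fun y => - alpha < y < alpha)); [|now apply interior].
      intros y Hy. symmetry. now apply is_derive_unique, D2.
    + apply (continuous_minus (fun t => u t * v t) (fun t => f (u t))); [|apply cf].
      apply (continuous_mult u v); auto.
  - intros x Hx. rewrite (is_derive_unique _ _ _ (D2 x Hx)), Dv.
    unfold f. rewrite clamp_id by now apply bnd'. unfold force. ring.
  (* The solution of the truncated system is defined on the whole line with [u' = v] continuous, so
     the one-sided limits are the values of [v] at the endpoints. *)
  - apply (filterlim_ext v); [easy|]. rewrite <- Hz, <- (ev alpha).
    eapply filterlim_filter_le_1; [apply filter_le_within|apply cv].
  - apply (filterlim_ext v); [easy|]. rewrite <- Hz.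
    eapply filterlim_filter_le_1; [apply filter_le_within|apply cv].
  - exists (alpha / 2). split; [lra|]. rewrite <- u0.
    apply (lt_of_derive_pos u v); [lra|now intros; apply du|]. intros; apply Hpos; lra.
  - exists (- (alpha / 2)). split; [lra|]. rewrite odd, <- Ropp_0. apply Ropp_lt_contravar.
    rewrite <- u0. apply (lt_of_derive_pos u v); [lra|now intros; apply du|]. intros; apply Hpos; lra.
Qed.
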